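(* Let $N,m\ge1$. For $k=1,\dots,N$ let $\mathcal{A}_k\in\{0,\ast,?\}^{n_k\times n_k}$, $\mathcal{B}_k\in\{0,\ast,?\}^{n_k\times1}$, $\mathcal{C}_k\in\{0,\ast,?\}^{1\times n_k}$ be such that $\mathcal{B}_k$ and $\mathcal{C}_k$ each have exactly one entry $\ast$ and all other entries $0$, and such that both $\begin{bmatrix}\mathcal{A}_k&\mathcal{B}_k\end{bmatrix}$ and $\begin{bmatrix}\bar{\mathcal{A}}_k&\mathcal{B}_k\end{bmatrix}$ have full row rank. Let $\mathcal{W}\in\{0,\ast,?\}^{N\times N}$, $\mathcal{H}\in\{0,\ast,?\}^{N\times m}$, and $\mathcal{A}=\mathrm{diag}(\mathcal{A}_1,\dots,\mathcal{A}_N)$, $\mathcal{B}=\mathrm{diag}(\mathcal{B}_1,\dots,\mathcal{B}_N)$, $\mathcal{C}=\mathrm{diag}(\mathcal{C}_1,\dots,\mathcal{C}_N)$. For each $k$ let $(\hat{\mathcal{A}}_k,\hat{\mathcal{B}}_k,\hat{\mathcal{C}}_k)$ be the standard node system corresponding to $(\mathcal{A}_k,\mathcal{B}_k,\mathcal{C}_k)$, and let $(\hat{\bar{\mathcal{A}}}_k,\hat{\bar{\mathcal{B}}}_k,\hat{\bar{\mathcal{C}}}_k)$ be the standard node system corresponding to $(\bar{\mathcal{A}}_k,\mathcal{B}_k,\mathcal{C}_k)$. Define the block diagonal pattern matrices $\hat{\mathcal{A}}=\mathrm{diag}(\hat{\mathcal{A}}_1,\dots,\hat{\mathcal{A}}_N)$,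 $\hat{\mathcal{B}}=\mathrm{diag}(\hat{\mathcal{B}}_1,\dots,\hat{\mathcal{B}}_N)$, $\hat{\mathcal{C}}=\mathrm{diag}(\hat{\mathcal{C}}_1,\dots,\hat{\mathcal{C}}_N)$ and $\hat{\bar{\mathcal{A}}}=\mathrm{diag}(\hat{\bar{\mathcal{A}}}_1,\dots,\hat{\bar{\mathcal{A}}}_N)$, $\hat{\bar{\mathcal{B}}}=\mathrm{diag}(\hat{\bar{\mathcal{B}}}_1,\dots,\hat{\bar{\mathcal{B}}}_N)$, $\hat{\bar{\mathcal{C}}}=\mathrm{diag}(\hat{\bar{\mathcal{C}}}_1,\dots,\hat{\bar{\mathcal{C}}}_N)$. Then the structured network $(\mathcal{A},\mathcal{B},\mathcal{C},\mathcal{W},\mathcal{H})$ is controllable if and only if both pattern matrices $$\begin{bmatrix}\hat{\mathcal{A}}+\hat{\mathcal{B}}\mathcal{W}\hat{\mathcal{C}}&\hat{\mathcal{B}}\mathcal{H}\end{bmatrix}\quad\text{and}\quad\begin{bmatrix}\hat{\bar{\mathcal{A}}}+\hat{\bar{\mathcal{B}}}\mathcal{W}\hat{\bar{\mathcal{C}}}&\hat{\bar{\mathcal{B}}}\mathcal{H}\end{bmatrix}$$ have full row rank.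
   Context: Pattern matrices. A pattern matrix has entries in the symbols $\{0,\ast,?\}$. For $\mathcal{M}\in\{0,\ast,?\}^{p\times q}$ let $\mathcal{P}(\mathcal{M})=\{M\in\mathbb{R}^{p\times q}: M_{ij}=0\text{ if }\mathcal{M}_{ij}=0,\ M_{ij}\ne0\text{ if }\mathcal{M}_{ij}=\ast\}$. For $p\le q$, $\mathcal{M}$ has full row rank if every $M\in\mathcal{P}(\mathcal{M})$ has full row rank. Arithmetic of symbols: addition is commutative with $0+x=x$ for every symbol $x$, and $\ast+\ast=\ast+?=?+?=?$; multiplication is commutative with $0\cdot x=0$, $\ast\cdot\ast=\ast$, $\ast\cdot?=?\cdot?=?$. Pattern matrices are added entrywise and multiplied by $(\mathcal{M}\mathcal{N})_{ij}=\sum_\ell\mathcal{M}_{i\ell}\cdot\mathcal{N}_{\ell j}$. Block diagonal pattern matrices have $0$ entries off the diagonal blocks. For a square pattern matrix $\mathcal{X}$, $\bar{\mathcal{X}}$ denotes the pattern matrix with the same off-diagonal entries and with diagonal entries $\bar{\mathcal{X}}_{ii}=\ast$ if $\mathcal{X}_{ii}=0$ and $\bar{\mathcal{X}}_{ii}=?$ otherwise. Network controllability. The structured network $(\mathcal{A},\mathcal{B},\mathcal{C},\mathcal{W},\mathcal{H})$ is controllable if $\dot x=(A+BWC)x+BHu$ is controllable for all $A\in\mathcal{P}(\mathcal{A})$, $B\in\mathcal{P}(\mathcal{B})$, $C\in\mathcal{P}(\mathcal{C})$, $W\in\mathcal{P}(\mathcal{W})$, $H\in\mathcal{P}(\mathcal{H})$.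 Independence. For $\mathcal{M}\in\{0,\ast,?\}^{1\times q}$ and $\mathcal{N}\in\{0,\ast,?\}^{r\times q}$ ($r\ge0$), $\mathcal{M}$ is independent of $\mathcal{N}$ if for all $M\in\mathcal{P}(\mathcal{M})$, $N\in\mathcal{P}(\mathcal{N})$, $z_1\in\mathbb{R}$, $z_2\in\mathbb{R}^r$: $z_1M+z_2^\top N=0$ implies $z_1=0$. Conditions. Consider a node system $(\mathcal{A}_\circ,\mathcal{B}_\circ,\mathcal{C}_\circ)$ with $\mathcal{A}_\circ$ square of size $\nu\ge 1$, $\mathcal{B}_\circ$ a column and $\mathcal{C}_\circ$ a row of length $\nu$, each of the latter having exactly one $\ast$ entry and zeros elsewhere, and with $\begin{bmatrix}\mathcal{A}_\circ&\mathcal{B}_\circ\end{bmatrix}$ of full row rank. Let $\mathcal{A}_{\circ,1}$ be the row of $\mathcal{A}_\circ$ at the position of the $\ast$ entry of $\mathcal{B}_\circ$, and $\mathcal{A}_{\circ,2}$ be $\mathcal{A}_\circ$ with that row removed. Write $\mathrm{col}(X,Y)$ for $X$ stacked on top of $Y$. Properties: (S1) $\mathcal{A}_{\circ,1}$ is independent of $\mathrm{col}(\mathcal{A}_{\circ,2},\mathcal{C}_\circ)$; (S2) $\mathcal{A}_{\circ,1}$ is independent of $\mathcal{A}_{\circ,2}$; (S3) $\mathcal{C}_\circ$ is independent of $\mathcal{A}_\circ$; (S4) $\mathcal{C}_\circ$ is independent of $\mathcal{A}_{\circ,2}$. Exactly one of the following holds: (C1) (S1) holds; (C2) (S3) holds;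 (C3) (S2) and (S4) hold; (C4) (S2) holds but neither (S1) nor (S4) holds; (C5) (S4) holds but neither (S2) nor (S3) holds; (C6) neither (S2) nor (S4) holds. Standard node systems. If $(\mathcal{A}_\circ,\mathcal{B}_\circ,\mathcal{C}_\circ)$ satisfies (C$i$), the standard node system corresponding to it is $(\hat{\mathcal{A}}_{(Ci)},\hat{\mathcal{B}}_{(Ci)},\hat{\mathcal{C}}_{(Ci)})$, where $\hat{\mathcal{A}}_{(C1)}=\begin{bmatrix}0&\ast\\\ast&0\end{bmatrix}$, $\hat{\mathcal{A}}_{(C2)}=0$, $\hat{\mathcal{A}}_{(C3)}=\ast$, $\hat{\mathcal{A}}_{(C4)}=\begin{bmatrix}0&\ast\\\ast&?\end{bmatrix}$, $\hat{\mathcal{A}}_{(C5)}=\,?$, $\hat{\mathcal{A}}_{(C6)}=\begin{bmatrix}0&0\\\ast&0\end{bmatrix}$, and $\hat{\mathcal{B}}_{(Ci)}^\top=\hat{\mathcal{C}}_{(Ci)}=\begin{bmatrix}\ast&0\end{bmatrix}$ for $i=1,4,6$, while $\hat{\mathcal{B}}_{(Ci)}=\hat{\mathcal{C}}_{(Ci)}=\ast$ (a $1\times1$ pattern) for $i=2,3,5$. *)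

(* Defs.v *)
From HB Require Import structures.
From mathcomp Require Import all_boot all_order all_algebra.
From mathcomp Require Import all_classical all_reals all_analysis.

Set Implicit Arguments.
Unset Strict Implicit.
Unset Printing Implicit Defensive.

Import Order.TTheory GRing.Theory Num.Theory.
Import numFieldNormedType.Exports.

Local Open Scope ring_scope.

Inductive sym := Zero | Star | Any.

Definition sym_code (x : sym) : option bool :=
  match x with Zero => None | Star => Some false | Any => Some true end.

Definition sym_decode (c : option bool) : sym :=
  match c with None => Zero | Some false => Star | Some true => Any end.

Lemma sym_codeK : cancel sym_code sym_decode.
Proof. by case. Qed.

HB.instance Definition _ := Countable.copy sym (can_type sym_codeK).

Definition add_sym (x y : sym) : sym :=
  match x, y with
  | Zero, _ => y
  | _, Zero => x
  | _, _ => Any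
  end.

Definition mul_sym (x y : sym) : sym :=
  match x, y with
  | Zero, _ | _, Zero => Zero
  | Star, Star => Star
  | _, _ => Any
  end.

Lemma add_symA : associative add_sym. Proof. by do 3!case. Qed.
Lemma add_symC : commutative add_sym. Proof. by do 2!case. Qed.
Lemma add_sym0 : left_id Zero add_sym. Proof. by case. Qed.
Lemma mul_symA : associative mul_sym. Proof. by do 3!case. Qed.
Lemma mul_symC : commutative mul_sym. Proof. by do 2!case. Qed.
Lemma mul_sym1 : left_id Star mul_sym. Proof. by case. Qed.
Lemma mul_symDl : left_distributive mul_sym add_sym.
Proof. by do 3!case. Qed.
Lemma mul_sym0 : left_zero Zero mul_sym. Proof. by case. Qed.
Lemma Star_neq0 : Star != Zero. Proof. by []. Qed.

(* The symbols form a commutative semiring with zero [Zero] and unit [Star], so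
   the library's [+] and [*m] on ['M[sym]_(p, q)] are the sum and product of
   pattern matrices. *)
HB.instance Definition _ := GRing.isNmodule.Build sym add_symA add_symC add_sym0.
HB.instance Definition _ := GRing.Nmodule_isComNzSemiRing.Build sym
  mul_symA mul_symC mul_sym1 mul_symDl mul_sym0 Star_neq0.

Definition sym_admits (R : realType) (s : sym) (x : R) : Prop :=
  match s with Zero => x = 0 | Star => x <> 0 | Any => True end.

Definition in_pattern (R : realType) (p q : nat)
    (M : 'M[sym]_(p, q)) (X : 'M[R]_(p, q)) : Prop :=
  forall i j, sym_admits (M i j) (X i j).

Definition full_row_rank (R : realType) (p q : nat) (M : 'M[sym]_(p, q)) : Prop :=
  forall X : 'M[R]_(p, q), in_pattern M X -> row_free X.

(* [bar_pattern X] is the pattern written with a bar over [X]. *)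
Definition bar_pattern (n : nat) (X : 'M[sym]_n) : 'M[sym]_n :=
  \matrix_(i, j)
    if i == j then (if X i j == Zero then Star else Any) else X i j.

(* Block diagonal patterns whose blocks are columns, resp. rows; for square
   blocks the library's [\mxdiag] is used. *)
Definition diag_cols (N : nat) (n : 'I_N -> nat)
    (B : forall k, 'cV[sym]_(n k)) : 'M[sym]_(\sum_k n k, N) :=
  \mxcol_(k < N) \matrix_(i < n k, j < N) if j == k then B k i ord0 else Zero.

Definition diag_rows (N : nat) (n : 'I_N -> nat)
    (C : forall k, 'rV[sym]_(n k)) : 'M[sym]_(N, \sum_k n k) :=
  \mxrow_(k < N) \matrix_(i < N, j < n k) if i == k then C k ord0 j else Zero.

(* Every state can be steered to every other one in some positive time.
   Inputs are continuous; as the equation is linear, solutions are then defined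
   on the whole line, and the pairs of states connected in time [T] are the same
   as for piecewise continuous or locally integrable inputs. *)
Definition controllable (R : realType) (n m : nat)
    (A : 'M[R]_n) (B : 'M[R]_(n, m)) : Prop :=
  forall x0 x1 : 'cV[R]_n,
  exists (T : R) (u : R -> 'cV[R]_m) (x : R -> 'cV[R]_n),
    [/\ 0 < T, continuous u,
        forall t : R, is_derive t (1 : R) x (A *m x t + B *m u t),
        x 0 = x0 & x T = x1].

Definition network_controllable (R : realType) (n N m : nat)
    (A : 'M[sym]_n) (B : 'M[sym]_(n, N)) (C : 'M[sym]_(N, n))
    (W : 'M[sym]_N) (H : 'M[sym]_(N, m)) : Prop :=
  forall (A' : 'M[R]_n) (B' : 'M[R]_(n, N)) (C' : 'M[R]_(N, n))
         (W' : 'M[R]_N) (H' : 'M[R]_(N, m)),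
    in_pattern A A' -> in_pattern B B' -> in_pattern C C' ->
    in_pattern W W' -> in_pattern H H' ->
    controllable (A' + B' *m W' *m C') (B' *m H').

Definition independent (R : realType) (q r : nat)
    (M : 'rV[sym]_q) (N : 'M[sym]_(r, q)) : Prop :=
  forall (M' : 'rV[R]_q) (N' : 'M[R]_(r, q)) (z1 : R) (z2 : 'cV[R]_r),
    in_pattern M M' -> in_pattern N N' ->
    z1 *: M' + z2^T *m N' = 0 -> z1 = 0.

Definition single_star_col (n : nat) (B : 'cV[sym]_n) : Prop :=
  exists i, forall j, B j ord0 = if j == i then Star else Zero.

Definition single_star_row (n : nat) (C : 'rV[sym]_n) : Prop :=
  exists i, forall j, C ord0 j = if j == i then Star else Zero.

Section NodeConditions.
Variables (R : realType) (n : nat).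
(* [i] is the position of the star entry of the input column: [row i A] is the
   row singled out by it, and [row' i A] is [A] without that row. *)
Variables (i : 'I_n) (A : 'M[sym]_n) (C : 'rV[sym]_n).

Definition S1 : Prop := independent R (row i A) (col_mx (row' i A) C).
Definition S2 : Prop := independent R (row i A) (row' i A).
Definition S3 : Prop := independent R C A.
Definition S4 : Prop := independent R C (row' i A).

End NodeConditions.

Inductive node_class := C1 | C2 | C3 | C4 | C5 | C6.

Definition node_cond (R : realType) (n : nat) (i : 'I_n)
    (A : 'M[sym]_n) (C : 'rV[sym]_n) (c : node_class) : Prop :=
  match c with
  | C1 => S1 R i A C
  | C2 => S3 R A C
  | C3 => S2 R i A /\ S4 R i A C
  | C4 => [/\ S2 R i A, ~ S1 R i A C & ~ S4 R i A C]
  | C5 => [/\ S4 R i A C, ~ S2 R i A & ~ S3 R A C]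
  | C6 => ~ S2 R i A /\ ~ S4 R i A C
  end.

Definition has_class (R : realType) (n : nat) (A : 'M[sym]_n)
    (B : 'cV[sym]_n) (C : 'rV[sym]_n) (c : node_class) : Prop :=
  exists i, B i ord0 = Star /\ node_cond R i A C c.

Definition std_dim (c : node_class) : nat :=
  match c with C1 | C4 | C6 => 2 | C2 | C3 | C5 => 1 end.

Definition mx_of_rows (p q : nat) (s : seq (seq sym)) : 'M[sym]_(p, q) :=
  \matrix_(i, j) nth Zero (nth [::] s i) j.

Definition std_A (c : node_class) : 'M[sym]_(std_dim c) :=
  mx_of_rows _ _
    match c with
    | C1 => [:: [:: Zero; Star]; [:: Star; Zero]]
    | C2 => [:: [:: Zero]]
    | C3 => [:: [:: Star]]
    | C4 => [:: [:: Zero; Star]; [:: Star; Any]]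
    | C5 => [:: [:: Any]]
    | C6 => [:: [:: Zero; Zero]; [:: Star; Zero]]
    end.

Definition std_C (c : node_class) : 'rV[sym]_(std_dim c) :=
  mx_of_rows _ _
    match c with
    | C1 | C4 | C6 => [:: [:: Star; Zero]]
    | C2 | C3 | C5 => [:: [:: Star]]
    end.

Definition std_B (c : node_class) : 'cV[sym]_(std_dim c) := (std_C c)^T.

Definition std_network (N m : nat) (c : 'I_N -> node_class)
    (W : 'M[sym]_N) (H : 'M[sym]_(N, m)) :=
  let A := \mxdiag_(k < N) std_A (c k) in
  let B := diag_cols (fun k => std_B (c k)) in
  let C := diag_rows (fun k => std_C (c k)) in
  row_mx (A + B *m W *m C) (B *m H).
(* A node system satisfies exactly one of the six conditions: the standard node
   system corresponding to it exists and is unique. *)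
Section ClassUnique.
Variables (R : realType) (n : nat) (i : 'I_n) (A : 'M[sym]_n) (C : 'rV[sym]_n).

Let realize (p q : nat) (M : 'M[sym]_(p, q)) : 'M[R]_(p, q) :=
  map_mx (fun s => if s == Zero then 0 else 1) M.

Let realizeP (p q : nat) (M : 'M[sym]_(p, q)) : in_pattern M (realize M).
Proof.
by move=> k l; rewrite mxE; case: (M k l) => //=; apply/eqP; exact: oner_neq0.
Qed.

Let mul_row' (a : 'rV[R]_n) (X : 'M[R]_n) :
  a *m X = a ord0 i *: row i X + (col' i a) *m row' i X.
Proof.
apply/rowP => l; rewrite !mxE (bigD1_ord i) //=; congr (_ + _).
by apply: eq_bigr => k _; rewrite !mxE.
Qed.

Let S1_S2 : S1 R i A C -> S2 R i A.
Proof.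
move=> h M N z1 z2 hM hN e.
apply: (h M (col_mx N (realize C)) z1 (col_mx z2 0) hM).
  move=> k l; rewrite !mxE; case: fintype.split => k'; first exact: hN.
  exact: realizeP.
by rewrite tr_col_mx trmx0 mul_row_col mul0mx addr0.
Qed.

Let S3_S4 : S3 R A C -> S4 R i A C.
Proof.
move=> h M N z1 z2 hM hN e.
pose X := \matrix_(k, l) if unlift i k is Some k' then N k' l else realize A k l.
pose z := \col_k (if unlift i k is Some k' then z2 k' ord0 else 0).
apply: (h M X z1 z hM).
  move=> k l; rewrite mxE; case: unliftP => [k' ->|->]; last exact: realizeP.
  by have := hN k' l; rewrite mxE.
rewrite mul_row' !mxE unlift_none scale0r add0r -[RHS]e; congr (_ + _ *m _).
  by apply/rowP => k; rewrite !mxE liftK.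
by apply/matrixP => k l; rewrite !mxE liftK.
Qed.

Let relation (B : 'cV[sym]_n) :
    (forall j, B j ord0 = if j == i then Star else Zero) ->
    full_row_rank R (row_mx A B) ->
  exists (a : 'rV[R]_n) (z : R),
    a *m realize A + z *: realize C = 0 /\ ((a ord0 i != 0) || (z != 0)).
Proof.
move=> hB hAB; pose X := col_mx (realize A) (realize C).
have : kermx X != 0.
  rewrite kermx_eq0 -row_leq_rank -ltnNge; apply: (leq_ltn_trans (rank_leq_col _)); by rewrite addn1.
move=> /rowV0Pn[v] /sub_kermxP; rewrite -[v]hsubmxK mul_row_col.
move: (lsubmx v) (rsubmx v) => a y e v0.
exists a, (y ord0 ord0); split.
  by rewrite -[RHS]e; congr (_ + _); apply/rowP => l;
    rewrite !mxE big_ord1 !mxE.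
apply: contraNT v0; rewrite negb_or !negbK => /andP[/eqP ai /eqP y0].
have y0' : y = 0 by apply/rowP => k; rewrite ord1 y0 mxE.
rewrite y0' in e *.
suff -> : a = 0 by rewrite row_mx0.
have free : row_free (row_mx (realize A) (realize B)).
  apply: hAB => k l; rewrite !mxE; case: fintype.split => l'; exact: realizeP.
apply: (row_free_inj free); rewrite mul0mx mul_mx_row.
move: e; rewrite mul0mx addr0 => ->.
suff -> : a *m realize B = 0 by rewrite row_mx0.
apply/colP => k; rewrite ord1 !mxE (bigD1 i) //= ai mul0r add0r.
by apply: big1 => j ji; rewrite !mxE hB (negbTE ji) /= mulr0.
Qed.

Lemma node_cond_uniq (B : 'cV[sym]_n) :
    (forall j, B j ord0 = if j == i then Star else Zero) ->
    full_row_rank R (row_mx A B) ->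
  exists! c, node_cond R i A C c.
Proof.
move=> hB hAB; have [a [z [e nz]]] := relation hB hAB.
have r1 : S1 R i A C -> a ord0 i = 0.
  move=> h; apply: (h (row i (realize A))
    (col_mx (row' i (realize A)) (realize C)) _ (col_mx (col' i a)^T z%:M)).
  - by move=> k l; have := @realizeP _ _ A i l; rewrite !mxE.
  - move=> k l; rewrite !mxE; case: fintype.split => k'; rewrite !mxE.
      by have := @realizeP _ _ A (lift i k') l; rewrite mxE.
    by have := @realizeP _ _ C k' l; rewrite mxE.
  - rewrite tr_col_mx trmxK tr_scalar_mx mul_row_col mul_scalar_mx addrA.
    by rewrite -mul_row'.
have r2 : S2 R i A -> z = 0 -> a ord0 i = 0.
  move=> h z0; apply: (h (row i (realize A)) (row' i (realize A)) _ (col' i a)^T).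
  - by move=> k l; have := @realizeP _ _ A i l; rewrite !mxE.
  - by move=> k l; have := @realizeP _ _ A (lift i k) l; rewrite !mxE.
  - by rewrite trmxK -mul_row' -[RHS]e z0 scale0r addr0.
have r3 : S3 R A C -> z = 0.
  move=> h; apply: (h (realize C) (realize A) _ a^T) => //.
  by rewrite trmxK addrC.
have r4 : S4 R i A C -> a ord0 i = 0 -> z = 0.
  move=> h a0; apply: (h (realize C) (row' i (realize A)) _ (col' i a)^T) => //.
  - by move=> k l; have := @realizeP _ _ A (lift i k) l; rewrite !mxE.
  - by rewrite trmxK addrC -[RHS]e mul_row' a0 scale0r add0r.
have no : ~ (a ord0 i = 0 /\ z = 0) by case=> a0 z0; rewrite a0 z0 eqxx in nz.
have s12 := S1_S2; have s34 := S3_S4.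
have excl c c' : node_cond R i A C c -> node_cond R i A C c' -> c = c'.
  case: c; case: c' => //= h h'; exfalso;
    repeat match goal with H : [/\ _, _ & _] |- _ => case: H => * end; tauto.
suff [c hc] : exists c, node_cond R i A C c by exists c; split=> // c'; exact: excl.
have [h2|h2] := pselect (S2 R i A); have [h4|h4] := pselect (S4 R i A C).
- by exists C3.
- by have [h1|h1] := pselect (S1 R i A C); [exists C1|exists C4].
- by have [h3|h3] := pselect (S3 R A C); [exists C2|exists C5].
- by exists C6.
Qed.

End ClassUnique.

Lemma has_class_uniq (R : realType) (n : nat) (A : 'M[sym]_n)
    (B : 'cV[sym]_n) (C : 'rV[sym]_n) :
    single_star_col B -> full_row_rank R (row_mx A B) ->
  exists! c, has_class R A B C c.
Proof.
case=> i hB hAB; have [c [hc uc]] := node_cond_uniq C hB hAB.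
exists c; split=> [|c' [j [hj hc']]].
  by exists i; split=> //; rewrite hB eqxx.
by apply: uc; move: hj hc'; rewrite hB; case: eqP => // ->.
Qed.

(* Main.v *)
Require Import Defs.
From mathcomp Require Import all_boot all_order all_algebra.
From mathcomp Require Import all_classical all_reals all_analysis.
From mathcomp Require Import ring.

Set Implicit Arguments.
Unset Strict Implicit.
Unset Printing Implicit Defensive.

Import Order.TTheory GRing.Theory Num.Theory.
Import numFieldNormedType.Exports.

Local Open Scope ring_scope.

(** Full row rank of a pattern is a property of symbols only. A set [s] of
rows is the support of a vanishing combination of the rows of some realization
exactly when no column sum over [s], computed with symbols, is a star
([full_row_rankP]). Indeed sums and products of symbols describe exactly the
reals that they admit, and a star is the only symbol that excludes zero. The
independence conditions on the nodes translate in the same way ([dependentP]).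

The bar operation is the addition of the identity pattern ([bar_patternE]),
and the realizations of the network are all the realizations of the pair of
patterns [A + B W C] and [B H] ([network_controllableP]). So the theorem has
two parts.

First, all realizations of a pair of patterns [(A, B)] are controllable if and
only if [row_mx A B] and [row_mx (A + 1) B] have full row rank
([strong_controllabilityP]). A failing rank condition yields a realization
with a left eigenvector, for the eigenvalue 0 or 1, that annihilates the input
matrix, and such a system is not controllable
([eigenvector_not_controllable]). Conversely, when no nonzero invariant space
of row vectors annihilates the input matrix ([pattern_no_invariant]), the
system can be steered along polynomial trajectories: [x = adj(d/dt - A) B y]
and [u = p(d/dt) y], with [p] the characteristic polynomial, solve the
equation for every [y], and Hermite interpolation prescribes the derivatives
of [y] at both ends ([flat_mx_controllable]).

Second, the rank of the network pattern depends on the nodes through their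
classes only ([standard_full_row_rank]). A set of rows that witnesses a loss
of rank splits into sets in the single nodes. The nodes see each other only
through the set of nodes whose input row is used, and through the symbols that
this set sends along [W] to the outputs ([network_full_row_rank]). Which
combinations a node can sustain is a table with six entries, and the class
determines it ([blocks_class_table]); the standard node of a class has the
same table ([std_blocks]). Applied to the given nodes and to their barred
versions, this turns the two rank conditions into those of the theorem. *)

(** * Arithmetic of symbols and of the reals they admit *)

Section Symbols.
Variable R : realType.
Implicit Types (a b : sym) (x y t : R).

Lemma admits_add a b x y :
  sym_admits a x -> sym_admits b y -> sym_admits (a + b) (x + y).
Proof.
case: a; case: b => //=; try by [move=> -> ->; rewrite addr0];
  try by [move=> -> ?; rewrite add0r].
by move=> ? ->; rewrite addr0.
Qed.

Lemma admits_mul a b x y :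
  sym_admits a x -> sym_admits b y -> sym_admits (a * b) (x * y).
Proof.
case: a; case: b => //=; try by [move=> -> _; rewrite mul0r];
  try by [move=> _ ->; rewrite mulr0].
move=> /eqP hx /eqP hy.
by apply/eqP; rewrite mulf_neq0.
Qed.

(** Together with [admits_add]: the reals admitted by [a + b] are exactly the
sums of reals admitted by [a] and by [b]. This is what makes the pattern of a
sum an exact description, not only an upper bound: two nonzero reals can have
any sum, which is why [Star + Star] is [Any]. *)
Lemma admits_split a b t (ht : sym_admits (a + b) t) :
  exists x y, [/\ sym_admits a x, sym_admits b y & t = x + y].
Proof.
have o0 : (1 : R) <> 0 by apply/eqP; exact: oner_neq0.
have t0 : (1 + 1 : R) <> 0 by apply/eqP; rewrite gt_eqF// addr_gt0.
move: ht; case: a; case: b => //= ht.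
- by exists 0, 0; rewrite addr0.
- by exists 0, t; rewrite add0r.
- by exists 0, t; rewrite add0r.
- by exists t, 0; rewrite addr0.
- have [->|/eqP t1] := eqVneq t 1.
    exists (1 + 1), (- 1); split=> //; last by rewrite addrK.
    by apply/eqP; rewrite oppr_eq0 oner_neq0.
  by exists 1, (t - 1); split=> //; [move/subr0_eq | rewrite addrC subrK].
- by exists 1, (t - 1); split=> //; rewrite addrC subrK.
- by exists t, 0; rewrite addr0.
- by exists (t - 1), 1; split=> //; rewrite subrK.
- by exists t, 0; rewrite addr0.
Qed.

Lemma admits_exists a : exists x, sym_admits a x.
Proof.
case: a => /=; [by exists 0 | exists 1 | by exists 0].
by apply/eqP; exact: oner_neq0.
Qed.

Lemma in_patternD p q (M N : 'M[sym]_(p, q)) (X Y : 'M[R]_(p, q)) :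
  in_pattern M X -> in_pattern N Y -> in_pattern (M + N) (X + Y).
Proof. by move=> hX hY i j; rewrite !mxE; apply: admits_add. Qed.

Lemma in_patternM p q r (M : 'M[sym]_(p, q)) (N : 'M[sym]_(q, r))
    (X : 'M[R]_(p, q)) (Y : 'M[R]_(q, r)) :
  in_pattern M X -> in_pattern N Y -> in_pattern (M *m N) (X *m Y).
Proof.
move=> hX hY i j; rewrite !mxE.
apply: (big_ind2 (fun s x => sym_admits s x)) => [//|a1 x1 b1 y1|].
  exact: admits_add.
by move=> k _; apply: admits_mul.
Qed.

Lemma in_pattern_row p q1 q2 (M : 'M[sym]_(p, q1)) (N : 'M[sym]_(p, q2))
    (X : 'M[R]_(p, q1)) (Y : 'M[R]_(p, q2)) :
  in_pattern (row_mx M N) (row_mx X Y) <-> in_pattern M X /\ in_pattern N Y.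
Proof.
split=> [h|[hX hY] i j]; last by rewrite !mxE; case: fintype.split.
by split=> i j; [have := h i (lshift _ j) | have := h i (rshift _ j)];
  rewrite ?row_mxEl ?row_mxEr.
Qed.

End Symbols.

(** * Sets of rows and full row rank *)

(** A set of row indices is stored as a Boolean row, so that the block
operations on matrices apply to it; [ind s *m M] is then the symbolic sum of
the rows of [M] that belong to [s]. *)
Definition ind p (s : 'rV[bool]_p) : 'rV[sym]_p :=
  map_mx (fun b : bool => if b then Star else Zero) s.

Definition supp (R : realType) p (z : 'rV[R]_p) : 'rV[bool]_p :=
  map_mx (fun x => x != 0) z.

Definition no_star q (v : 'rV[sym]_q) : Prop := forall j, v ord0 j <> Star.

Lemma no_star_row q1 q2 (u : 'rV[sym]_q1) (v : 'rV[sym]_q2) :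
  no_star (row_mx u v) <-> no_star u /\ no_star v.
Proof.
split=> [h|[hu hv] j]; last by rewrite mxE; case: fintype.split.
by split=> j; [have := h (lshift _ j) | have := h (rshift _ j)];
  rewrite ?row_mxEl ?row_mxEr.
Qed.

Section Combinatorics.
Variable R : realType.

Lemma in_pattern_supp p (z : 'rV[R]_p) : in_pattern (ind (supp z)) z.
Proof. by move=> i j; rewrite !mxE; case: eqP. Qed.

(** The star is the only symbol that does not admit zero: the rows without star
are the ones that can vanish. *)
Lemma no_starP q (v : 'rV[sym]_q) : no_star v <-> in_pattern v (0 : 'rV[R]_q).
Proof.
split=> [h i j|h j e]; last by have := h ord0 j; rewrite e mxE.
by rewrite ord1 mxE; move: (h j); case: (v ord0 j).
Qed.

Definition indR p (s : 'rV[bool]_p) : 'rV[R]_p :=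
  map_mx (fun b : bool => b%:R) s.

Lemma in_pattern_indR p (s : 'rV[bool]_p) : in_pattern (ind s) (indR s).
Proof.
by move=> i j; rewrite !mxE; case: (s i j) => //=; apply/eqP; exact: oner_neq0.
Qed.

(** The exactness of addition, iterated along one column: coefficients [z] of
known support can be combined with entries of prescribed symbols to reach any
value that the symbolic sum admits. *)
Lemma realize_column p (s v : 'I_p -> sym) (t : R) (z : 'I_p -> R) :
  (forall i, sym_admits (s i) (z i)) -> (forall i, s i <> Any) ->
  sym_admits (\sum_i s i * v i) t ->
  exists x : 'I_p -> R, (forall i, sym_admits (v i) (x i)) /\
    \sum_i z i * x i = t.
Proof.
elim: p s v t z => [|p IH] s v t z hz hs.
  rewrite !big_ord0 /= => ->.
  by exists (fun=> 0); split; [case | rewrite big_ord0].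
rewrite big_ord_recl => /admits_split[t0 [t1 [h0 /IH h1 ->]]].
have [x [hx hxt]] := h1 _ (fun i => hz _) (fun i => hs _).
have [x0 [hx0 e0]] : exists x0, sym_admits (v ord0) x0 /\ z ord0 * x0 = t0.
  move: (hz ord0) (hs ord0) h0; case: (s ord0) => //= hz0 _.
    move=> ->; have [x0] := admits_exists R (v ord0).
    by exists x0; rewrite hz0 mul0r.
  rewrite [(Star : sym) * _]mul1r => h0; exists ((z ord0)^-1 * t0).
  have zn0 : z ord0 != 0 by apply/eqP.
  split; last by rewrite mulVKf.
  move: h0; case: (v ord0) => //= [->|/eqP ?]; first by rewrite mulr0.
  by apply/eqP; rewrite mulf_neq0 ?invr_eq0.
exists (fun i => if unlift ord0 i is Some k then x k else x0); split.
  by move=> i; case: unliftP => [j ->|->].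
rewrite big_ord_recl unlift_none e0; congr (_ + _); rewrite -hxt.
by apply: eq_bigr => i _; rewrite liftK.
Qed.

(** The columns of a pattern matrix are chosen independently of each other. *)
Lemma realize_combination p q (s : 'rV[bool]_p) (M : 'M[sym]_(p, q))
    (z : 'rV[R]_p) (t : 'rV[R]_q) :
    in_pattern (ind s) z -> in_pattern (ind s *m M) t ->
  exists X, in_pattern M X /\ z *m X = t.
Proof.
move=> hz ht.
have [j|f hf] := choice (_ : forall j : 'I_q, exists x : 'I_p -> R,
    (forall i, sym_admits (M i j) (x i)) /\
    \sum_i z ord0 i * x i = t ord0 j).
  apply: (@realize_column _ (fun i => ind s ord0 i)).
  - by move=> i; apply: hz.
  - by move=> i; rewrite mxE; case: ifP.
  - by have := ht ord0 j; rewrite mxE.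
exists (\matrix_(i, j) f j i); split=> [i j|].
  by rewrite mxE; apply: (hf j).1.
apply/rowP => j; rewrite mxE -(hf j).2.
by apply: eq_bigr => i _; rewrite mxE.
Qed.

(** Full row rank is combinatorial: a nonzero vanishing combination of rows with
support [s] forces [ind s *m M] to be free of stars, and conversely such an [s]
yields a realization whose rows in [s] add up to zero. *)
Lemma full_row_rankP p q (M : 'M[sym]_(p, q)) :
  full_row_rank R M <->
  forall s : 'rV[bool]_p, no_star (ind s *m M) -> s = const_mx false.
Proof.
split=> [h s hs|h X hX].
  have [X [hX e]] :=
    realize_combination (in_pattern_indR s) ((no_starP _).1 hs).
  have /rowP z0 : indR s = 0.
    by apply: (row_free_inj (h X hX)); rewrite e mul0mx.
  apply/rowP => i; have := z0 i; rewrite !mxE; case: (s ord0 i) => // /eqP.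
  by rewrite oner_eq0.
rewrite -kermx_eq0; apply/eqP/row_matrixP => i; rewrite row0.
have e : row i (kermx X) *m X = 0 by rewrite -row_mul mulmx_ker row0.
have /h/rowP h0 : no_star (ind (supp (row i (kermx X))) *m M).
  apply/no_starP; rewrite -e; apply: in_patternM => //.
  exact: in_pattern_supp.
by apply/rowP => j; have := h0 j; rewrite !mxE => /negbFE/eqP.
Qed.

(** A vanishing combination in which the row from [M] takes part can be rescaled
and reduced to its support, as for full row rank. *)
Lemma dependentP q r (M : 'rV[sym]_q) (N : 'M[sym]_(r, q)) :
  ~ independent R M N <-> exists s : 'rV[bool]_r, no_star (M + ind s *m N).
Proof.
split=> [h|[s hs] h].
  apply: contrapT => hs; apply: h => M' N' z1 z2 hM hN e.
  apply: contrapT => /eqP z10; apply: hs; exists (supp z2^T).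
  apply/no_starP; rewrite -[X in in_pattern _ X]e; apply: in_patternD.
    move=> i j; rewrite mxE; have := hM i j; case: (M i j) => //=.
      by move=> ->; rewrite mulr0.
    by move/eqP=> ?; apply/eqP; rewrite mulf_neq0.
  by apply: in_patternM => //; exact: in_pattern_supp.
have /no_starP hs0 := hs.
have [j|f hf] := choice (_ : forall j : 'I_q, exists x : R,
    sym_admits (M ord0 j) x /\
    sym_admits ((ind s *m N) ord0 j) (- x)).
  have := hs0 ord0 j; rewrite !mxE => /admits_split[x [y [hx hy /eqP]]].
  by rewrite eq_sym addrC addr_eq0 => /eqP e; exists x; rewrite -e.
pose M' : 'rV[R]_q := \row_j f j.
have [|N' [hN e]] :=
  @realize_combination _ _ s N (indR s) (\row_j - f j) (in_pattern_indR s).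
  by move=> i j; rewrite ord1 [X in sym_admits _ X]mxE; apply: (hf j).2.
have hM : in_pattern M M' by move=> i j; rewrite ord1 mxE; apply: (hf j).1.
have := h M' N' 1 (indR s)^T hM hN.
have -> : 1 *: M' + (indR s)^T^T *m N' = 0.
  by apply/rowP => j; rewrite trmxK e scale1r !mxE addrN.
by move=> /(_ erefl)/eqP; rewrite oner_eq0.
Qed.

End Combinatorics.

(** * Trajectories of linear systems *)

Section Steering.
Variable R : realType.

Lemma is_derive_mxP p q (M : R -> 'M[R]_(p, q)) (D : 'M[R]_(p, q)) (t : R) :
  is_derive t (1 : R) M D <->
  forall i j, is_derive t (1 : R) (fun x => M x i j) (D i j).
Proof.
split=> [h i j|h].
  have dM : derivable M t 1 by [].
  have -> : D i j = 'D_1 (fun x => M x i j) t.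
    by rewrite -(@derive_val _ _ _ _ _ _ _ h) derive_mx// mxE.
  by apply: derivableP; apply: (derivable_mxP _ _ _).1.
have dM : derivable M t 1 by apply/derivable_mxP => i j; have [] := h i j.
apply: (is_derive_eq (derivableP dM)); apply/matrixP => i j.
by rewrite derive_mx// mxE; have [_] := h i j.
Qed.

Lemma is_derive_mulmx p q r (M : 'M[R]_(p, q)) (f : R -> 'M[R]_(q, r))
    (D : 'M[R]_(q, r)) (t : R) :
  is_derive t (1 : R) f D -> is_derive t (1 : R) (fun s => M *m f s) (M *m D).
Proof.
move=> /is_derive_mxP df; apply/is_derive_mxP => i j.
have -> : (fun s => (M *m f s) i j) = \sum_(k < q) (M i k \*: fun s => f s k j).
  by apply/funext => s; rewrite mxE fct_sumE.
by rewrite mxE; apply: is_derive_sum => k; apply: is_deriveZ.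
Qed.

(** The coordinate [y = z x] of a trajectory satisfies [y' = lam y] whatever the
input is; starting from [y 0 = 0] it stays zero, because [exp (- lam t) y]
has derivative zero, so the state [z^T] cannot be reached from the origin. *)
Lemma eigenvector_not_controllable n m (A : 'M[R]_n) (B : 'M[R]_(n, m))
    (z : 'rV[R]_n) (lam : R) :
  z != 0 -> z *m A = lam *: z -> z *m B = 0 -> ~ controllable A B.
Proof.
move=> z0 zA zB /(_ 0 z^T)[T [u [x [T0 _ dx x0 xT]]]].
pose y t := (z *m x t) ord0 ord0.
have dy t : is_derive t (1 : R) y (lam * y t).
  apply: (is_derive_eq ((is_derive_mxP _ _ _).1
    (is_derive_mulmx z (dx t)) ord0 ord0)).
  by rewrite mulmxDr !mulmxA zA zB mul0mx addr0 -scalemxAl mxE.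
pose f t := expR (- lam * t) * y t.
have df t : is_derive t (1 : R) f 0.
  have de : is_derive t (1 : R) (fun s => expR (- lam * s))
      (expR (- lam * t) * - lam).
    have dl : is_derive t (1 : R) (fun s => - lam * s) (- lam).
      apply: (is_derive_eq (is_deriveZ (- lam) (is_derive_id t (1 : R)))).
      by rewrite /GRing.scale/= mulr1.
    exact: (is_derive_eq (is_derive1_comp (is_derive_expR _) dl)).
  apply: (is_derive_eq (is_deriveM de (dy t))).
  by rewrite /GRing.scale/=; ring.
have := is_derive_0_is_cst T 0 df.
rewrite /f /y x0 xT mulmx0 [X in _ = _ * X]mxE mulr0 => /eqP.
rewrite mulf_eq0 gt_eqF ?expR_gt0//= mxE.
under eq_bigr do rewrite mxE -expr2.
rewrite psumr_eq0 => [/allP h|i _]; last exact: sqr_ge0.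
case/eqP: z0; apply/rowP => i; have := h i (mem_index_enum _).
by rewrite sqrf_eq0 !mxE => /eqP.
Qed.

(** At the root of the power only the terms with at least [n] derivatives on the
power survive. *)
Lemma derivnMXsubC (a : R) (n k : nat) (r : {poly R}) : (k <= n)%N ->
  ((r * ('X - a%:P) ^+ n)^`(k)).[a] = if k == n then n`!%:R * r.[a] else 0.
Proof.
elim: n k r => [|n IH] [|k] r kn; rewrite ?derivn0 //.
- by rewrite expr0 mulr1 eqxx mul1r.
- by rewrite hornerM exprS hornerM hornerXsubC subrr mul0r mulr0.
rewrite derivSn.
have -> : (r * ('X - a%:P) ^+ n.+1)^`() =
    (r^`() * ('X - a%:P) + r *+ n.+1) * ('X - a%:P) ^+ n.
  rewrite derivM deriv_exp derivXsubC mul1r succnK.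
  by rewrite mulrDl exprS mulrA mulrnAr mulrnAl.
rewrite IH // eqSS; case: ifP => // _.
by rewrite !hornerE hornerMn subrr mulr0 add0r factS natrM -mulr_natl; ring.
Qed.

(** Two-point Hermite interpolation: adding a multiple of ['X^n * ('X - 1)^n]
leaves the derivatives of order less than [n] at both points unchanged, and an
affine multiplier [l] adjusts the two derivatives of order [n] independently.
*)
Lemma hermite (n : nat) (c0 c1 : nat -> R) : exists y : {poly R},
  forall k, (k < n)%N -> (y^`(k)).[0] = c0 k /\ (y^`(k)).[1] = c1 k.
Proof.
elim: n => [|n [y hy]]; first by exists 0.
pose P0 : {poly R} := ('X - 0%:P) ^+ n; pose P1 : {poly R} := ('X - 1%:P) ^+ n.
pose a := (c0 n - (y^`(n)).[0]) / (n`!%:R * P1.[0]).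
pose b := (c1 n - (y^`(n)).[1]) / (n`!%:R * P0.[1]) - a.
pose l := a%:P + b *: 'X.
have fn : (n`!%:R : R) != 0 by rewrite pnatr_eq0 -lt0n fact_gt0.
have n0 : P1.[0] != 0.
  by rewrite /P1 horner_exp hornerXsubC expf_neq0// sub0r oppr_eq0 oner_neq0.
have n1 : P0.[1] != 0.
  by rewrite /P0 horner_exp hornerXsubC expf_neq0// subr0 oner_neq0.
have l0 : l.[0] = a by rewrite !hornerE.
have l1 : l.[1] = a + b by rewrite !hornerE.
exists (y + l * P1 * P0) => k; rewrite ltnS => kn.
have E0 : ((l * P1 * P0)^`(k)).[0] = if k == n then c0 n - (y^`(n)).[0] else 0.
  rewrite derivnMXsubC//; case: ifP => // _.
  by rewrite hornerM mulrCA l0 /a mulfVK// mulf_neq0.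
have E1 : ((l * P1 * P0)^`(k)).[1] = if k == n then c1 n - (y^`(n)).[1] else 0.
  rewrite mulrAC derivnMXsubC//; case: ifP => // _.
  by rewrite hornerM mulrCA l1 /b addrC subrK mulfVK// mulf_neq0.
rewrite derivnD !hornerD E0 E1; case: eqP kn => [-> _|/eqP nk kn].
  by rewrite ![_.[_] + _]addrC !subrK.
by rewrite !addr0; apply: hy; rewrite ltn_neqAle nk.
Qed.


Lemma flat_col_is_derive m (y : 'I_m -> {poly R}) (t : R) :
  is_derive t (1 : R) (fun s => \col_l (y l).[s]) (\col_l (y l)^`().[t]).
Proof.
apply/is_derive_mxP => i j; rewrite mxE.
have -> : (fun s => (\col_l (y l).[s]) i j) = horner (y i).
  by apply/funext => s; rewrite mxE.
exact: is_derive_poly.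
Qed.

Section Flatness.
Variables (n m : nat) (A : 'M[R]_n.+1) (B : 'M[R]_(n.+1, m)).

(** These matrices are the coefficients in [s] of the adjugate of [s - A],
shifted by one: with [p] the characteristic polynomial of [A], they
interpolate between [p(A) = 0] (at [k = 0]) and [0] (beyond the degree), by
Horner's scheme. *)
Definition tail_mx k : 'M[R]_n.+1 := horner_mx A (drop_poly k (char_poly A)).

Lemma tail_mx_rec k :
  tail_mx k = A *m tail_mx k.+1 + ((char_poly A)`_k)%:M.
Proof.
rewrite {1}/tail_mx; have -> : drop_poly k (char_poly A) =
    'X * drop_poly k.+1 (char_poly A) + ((char_poly A)`_k)%:P.
  apply/polyP => i; rewrite coefD coefXM coefC !coef_drop_poly.
  by case: i => [|i] /=; rewrite ?add0r ?addr0// addnS.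
by rewrite rmorphD rmorphM /= horner_mx_X horner_mx_C.
Qed.

Lemma tail_mx0 : tail_mx 0 = 0.
Proof. by rewrite /tail_mx drop_poly0l Cayley_Hamilton. Qed.

Lemma tail_mx_deg : tail_mx n.+2 = 0.
Proof. by rewrite /tail_mx drop_poly_eq0 ?size_char_poly// rmorph0. Qed.

(** Its columns are those of the coefficients of [adj(s - A) B]. *)
Definition flat_mx : 'M[R]_(n.+1, \sum_(k < n.+1) m) :=
  \mxrow_(k < n.+1) (tail_mx k.+1 *m B).

(** For an arbitrary smooth [y], the curve [x = adj(d/dt - A) B y] is a
trajectory for the input [u = p(d/dt) y], since [(s - A) adj(s - A) = p(s)].
Hence [x] at a given time is [flat_mx] applied to the derivatives of [y] of
order at most [n] at that time; these are free at times 0 and 1, and [flat_mx]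
is onto. *)
Lemma flat_mx_controllable : row_free flat_mx -> controllable A B.
Proof.
move=> /row_freeP[F FK] x0 x1.
pose c0 k := submxcol (F *m x0) k; pose c1 k := submxcol (F *m x1) k.
have /choice[y hy] : forall l : 'I_m, exists y : {poly R}, forall k : 'I_n.+1,
    (y^`(k)).[0] = c0 k l ord0 /\ (y^`(k)).[1] = c1 k l ord0.
  move=> l; have [y hy] := hermite n.+1 (fun k => c0 (inord k) l ord0)
    (fun k => c1 (inord k) l ord0).
  by exists y => k; have := hy k (ltn_ord k); rewrite inord_val.
pose Y k t := \col_l ((y l)^`(k)).[t].
have dY k t : is_derive t (1 : R) (Y k) (Y k.+1 t).
  by apply: flat_col_is_derive.
pose x t := \sum_(k < n.+1) tail_mx k.+1 *m B *m Y k t.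
pose u t := \sum_(k < n.+2) (char_poly A)`_k *: Y k t.
have x_at t c (e : forall k : 'I_n.+1, Y k t = submxcol (F *m c) k) : x t = c.
  rewrite -[RHS]mul1mx -FK -mulmxA -[F *m c]submxcolK mul_mxrow_mxcol.
  by apply: eq_bigr => k _; rewrite e.
exists 1, u, x; split=> //.
- move=> t; apply/differentiable_continuous/derivable1_diffP.
  have -> : u = \sum_(k < n.+2) ((char_poly A)`_k \*: Y k).
    by apply/funext => s; rewrite fct_sumE.
  by apply: derivable_sum => k; apply: derivableZ; have [] := dY k t.
- move=> t; have -> : x = \sum_(k < n.+1) fun s => tail_mx k.+1 *m B *m Y k s.
    by apply/funext => s; rewrite fct_sumE.
  apply: (is_derive_eq (is_derive_sum (fun k => is_derive_mulmx _ (dY k t)))).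
  transitivity (\sum_(k < n.+2) tail_mx k *m B *m Y k t).
    by rewrite [RHS]big_ord_recl [tail_mx (@ord0 n.+1)]tail_mx0 !mul0mx add0r.
  rewrite fct_sumE /u.
  under eq_bigr do rewrite tail_mx_rec !mulmxDl mul_scalar_mx -scalemxAl.
  rewrite big_split big_ord_recr/= tail_mx_deg mulmx0 !mul0mx addr0.
  rewrite mulmx_sumr [in RHS]mulmx_sumr; congr (_ + _).
    by apply: eq_bigr => k _; rewrite !mulmxA.
  by apply: eq_bigr => k _; rewrite scalemxAr.
- by apply: x_at => k; apply/colP => l; rewrite mxE (hy l k).1.
- by apply: x_at => k; apply/colP => l; rewrite mxE (hy l k).2.
Qed.

(** Reading the Horner recursion modulo [K *m B = 0]: multiplying by [A] turns
the block [k + 1] of [flat_mx] into the block [k], and the last block is [B].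
*)
Lemma kermx_flat_mx (K := kermx flat_mx) :
  (K *m A <= K)%MS /\ K *m B = 0.
Proof.
have kN (k : 'I_n.+1) : K *m (tail_mx k.+1 *m B) = 0.
  have : K *m flat_mx = 0 by apply: mulmx_ker.
  rewrite mul_mxrow => /(congr1 (fun M => submxrow M k)).
  by rewrite mxrowK => ->; apply/matrixP => i j; rewrite !mxE.
have kB : K *m B = 0.
  have := kN ord_max; rewrite tail_mx_rec tail_mx_deg mulmx0 add0r.
  have -> : (char_poly A)`_(@ord_max n).+1 = 1.
    by have /monicP := char_poly_monic A; rewrite lead_coefE size_char_poly.
  by rewrite mul1mx.
have kN' (k : 'I_n.+1) : K *m (tail_mx k *m B) = 0.
  case: k => [[|k] /= kn]; first by rewrite tail_mx0 mul0mx mulmx0.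
  exact: (kN (Ordinal (ltnW kn))).
split=> //; apply/sub_kermxP; rewrite mul_mxrow; apply/mxrowP => k.
rewrite mxrowK; transitivity (0 : 'M[R]_(n.+1, m)); last first.
  by apply/matrixP => i j; rewrite !mxE.
have := kN' k; rewrite tail_mx_rec mulmxDl mulmxDr mul_scalar_mx -scalemxAr kB.
by rewrite scaler0 addr0 !mulmxA.
Qed.
End Flatness.

End Steering.

(** * Controllability of all realizations of a pair of patterns *)

Section Strong.
Variable R : realType.

(** Two nonzero symbols never add up to [Star] or to [Zero]. *)
Lemma sum_sym_star (I : finType) (v : I -> sym) :
  \sum_i v i = Star -> exists i, v i = Star /\ forall k, k != i -> v k = Zero.
Proof.
have add0 a b : add_sym a b = Zero -> a = Zero /\ b = Zero by case: a; case: b.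
have sum0 (P : pred I) :
    \sum_(i | P i) v i = Zero -> forall i, P i -> v i = Zero.
  by move=> + i Pi; rewrite (bigD1 i)//= => /add0[].
move=> e.
have [i vi] : exists i, v i <> Zero.
  apply: contrapT => h; have : \sum_i v i = 0.
    by apply: big1 => i _; apply: contrapT => vi; apply: h; exists i.
  by rewrite e.
move: e; rewrite (bigD1 i)//= => e; exists i.
have [-> r0] : v i = Star /\ \sum_(k | k != i) v k = Zero.
  by move: e vi; case: (v i); case: (\sum_(k | k != i) v k).
by split=> // k ki; apply: (sum0 _ r0).
Qed.

Lemma ind_mul_star p q (s : 'rV[bool]_p) (M : 'M[sym]_(p, q)) j :
  (ind s *m M) ord0 j = Star ->
  exists i, [/\ s ord0 i, M i j = Star &
    forall k, k != i -> s ord0 k -> M k j = Zero].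
Proof.
rewrite mxE => /sum_sym_star[i []]; rewrite mxE; case: ifP => // si Mij h.
exists i; split=> // [|k ki sk].
  by move: Mij; rewrite [(Star : sym) * _]mul1r.
by have := h k ki; rewrite mxE sk [(Star : sym) * _]mul1r.
Qed.

(** Let [s] be the union of the supports of the vectors in the row space of
[K]. The rank of [row_mx (A + 1) B] gives a column of it with a single nonzero
entry on [s], and that entry is a star. If the column lies in [B], then [K *m
Y] is nonzero. If it is column [j] of [A + 1] with [j] outside [s], then [K *m
X] leaves the support of [K]. The remaining possibility is that [j] is in [s]
and column [j] of [A] vanishes on [s]; then [X] maps the row space of [K] into
a proper subspace of itself, so it kills a nonzero vector of it, which [Y]
kills as well: this contradicts the rank of [row_mx A B]. The argument stays
over the reals, although the spectrum of [X] need not. *)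
Lemma pattern_no_invariant n m (A : 'M[sym]_n) (B : 'M[sym]_(n, m))
    (X : 'M[R]_n) (Y : 'M[R]_(n, m)) (K : 'M[R]_n) :
  full_row_rank R (row_mx A B) -> full_row_rank R (row_mx (A + 1%:M) B) ->
  in_pattern A X -> in_pattern B Y -> (K *m X <= K)%MS -> K *m Y = 0 -> K = 0.
Proof.
move=> fAB fAB1 hX hY KX KY; apply: contrapT => K0.
pose s := \row_i (col i K != 0).
have s0 : s <> const_mx false.
  move=> /rowP e; apply: K0; apply/matrixP => i j; have := e j.
  by rewrite !mxE => /negbFE/eqP/colP/(_ i); rewrite !mxE.
have sP k i : ~~ s ord0 k -> K i k = 0.
  by rewrite mxE negbK => /eqP/colP/(_ i); rewrite !mxE.
(* On such a column every vector of K sees just its coordinate i. *)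
have one q (Z : 'M[R]_(n, q)) i j : s ord0 i -> Z i j <> 0 ->
    (forall k, k != i -> s ord0 k -> Z k j = 0) -> exists l, (K *m Z) l j <> 0.
  rewrite mxE => si Zij h.
  have [l Kl] : exists l, K l i <> 0.
    apply: contrapT => hK; case/eqP: si; apply/colP => l; rewrite !mxE.
    by apply: contrapT => Kl; apply: hK; exists l.
  exists l; rewrite mxE (bigD1 i)//= big1 ?addr0 => [|k ki].
    by apply/eqP; rewrite mulf_neq0//; apply/eqP.
  have [sk|sk] := boolP (s ord0 k); first by rewrite h// mulr0.
  by rewrite sP// mul0r.
have [j] : exists j, (ind s *m row_mx (A + 1%:M) B) ord0 j = Star.
  apply: contrapT => hj; apply: s0; apply: (full_row_rankP R _).1 fAB1 _ _.
  by move=> j e; apply: hj; exists j.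
case/ind_mul_star => i [si Mij hk].
case: (split_ordP j) => j' ej; rewrite {j}ej in Mij hk; last first.
  have [||l] := one _ Y i j' si.
  - by have := hY i j'; move: Mij; rewrite row_mxEr => ->.
  - move=> k ki sk; have := hY k j'; have := hk k ki sk.
    by rewrite row_mxEr => ->.
  - by rewrite KY mxE.
rewrite row_mxEl in Mij.
have {}hk k : k != i -> s ord0 k -> (A + 1%:M) k j' = Zero.
  by move=> ki sk; have := hk k ki sk; rewrite row_mxEl.
have Ak k : k != i -> s ord0 k -> A k j' = Zero.
  move=> ki sk; have := hk k ki sk; rewrite mxE.
  by case: (A k j'); case: (_ k j').
have [sj|sj] := boolP (s ord0 j'); last first.
  (* Some row of K X has a nonzero coordinate at j', outside s. *)
  have ij : i != j' by apply: contraNneq sj => <-.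
  have [||l] := one _ X i j' si.
  - have := hX i j'; move: Mij.
    by rewrite !mxE (negbTE ij) mulr0n addr0 => ->.
  - by move=> k ki sk; have := hX k j'; rewrite Ak.
  - case/submxP: KX => G ->; rewrite mxE big1// => k _.
    by rewrite sP// mulr0.
(* Column i of K X vanishes, that of K does not: the inclusion is strict. *)
have ij : i = j'.
  apply/eqP; apply: contraT; rewrite eq_sym => ji.
  by have := hk j' ji sj; rewrite !mxE eqxx; case: (A j' j').
subst j'.
have Aii : A i i = Zero by move: Mij; rewrite !mxE eqxx; case: (A i i).
have KXi l : (K *m X) l i = 0.
  rewrite mxE big1// => k _.
  have [sk|sk] := boolP (s ord0 k); last by rewrite sP// mul0r.
  have -> : X k i = 0; last by rewrite mulr0.
  by have := hX k i; have [->|/Ak->//] := eqVneq k i; rewrite Aii.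
have ltK : (K *m X < K)%MS.
  rewrite ltmxE KX; apply/negP => /submxP[G e].
  move: si; rewrite mxE => /eqP; apply; apply/colP => l.
  rewrite mxE e mxE big1 ?mxE// => k _.
  by rewrite KXi mulr0.
have : (K :&: kermx X)%MS != 0.
  rewrite -mxrank_eq0; apply: contraTneq (rank_ltmx ltK) => r0.
  by rewrite -(mxrank_mul_ker K X) r0 addn0 ltnn.
move=> /rowV0Pn[v]; rewrite sub_capmx => /andP[/submxP[G vK] /sub_kermxP vX] v0.
have fXY : row_free (row_mx X Y) by apply: fAB; apply/in_pattern_row.
case/eqP: v0; apply: (row_free_inj fXY).
by rewrite mul0mx mul_mx_row vX vK -mulmxA KY mulmx0 row_mx0.
Qed.

Lemma controllable_dim0 m (A : 'M[R]_0) (B : 'M[R]_(0, m)) : controllable A B.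
Proof.
move=> x0 x1; exists 1, (fun=> 0), (fun=> 0).
split; rewrite ?ltr01//; try by apply/matrixP => [[]].
  exact: cst_continuous.
by move=> t; apply/is_derive_mxP => [[]].
Qed.

(** If a rank condition fails for the set [s], the sum of the rows in [s] of a
suitable realization is [lam] times the indicator of [s], with [lam = 0] for
[A] and [lam = 1] for [A + 1]: at an index of [s], a symbol [a] with [a +
Star] different from a star is nonzero and hence admits 1. That indicator is a
left eigenvector which annihilates the input matrix. *)
Lemma strong_controllabilityP n m (A : 'M[sym]_n) (B : 'M[sym]_(n, m)) :
  (forall (X : 'M[R]_n) (Y : 'M[R]_(n, m)),
    in_pattern A X -> in_pattern B Y -> controllable X Y) <->
  full_row_rank R (row_mx A B) /\ full_row_rank R (row_mx (A + 1%:M) B).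
Proof.
split=> [h|[fAB fAB1] X Y hX hY]; last first.
  case: n A B X Y fAB fAB1 hX hY => [|n] A B X Y fAB fAB1 hX hY.
    exact: controllable_dim0.
  have [KX KY] := kermx_flat_mx X Y.
  apply: flat_mx_controllable; rewrite -kermx_eq0; apply/eqP.
  exact: (pattern_no_invariant fAB fAB1 hX hY).
have key (s : 'rV[bool]_n) (lam : R) :
    in_pattern (ind s *m A) (lam *: indR R s) -> no_star (ind s *m B) ->
    s = const_mx false.
  move=> hA hB; apply: contrapT => s0.
  have [X [hX zX]] :=
    realize_combination (in_pattern_indR R s) hA.
  have [Y [hY zY]] :=
    realize_combination (in_pattern_indR R s) ((no_starP R _).1 hB).
  have z0 : indR R s != 0.
    apply: contra_notN s0 => /eqP/rowP e; apply/rowP => i; have := e i.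
    by rewrite !mxE; case: (s ord0 i) => // /eqP; rewrite oner_eq0.
  exact: (eigenvector_not_controllable z0 zX zY) (h _ _ hX hY).
split; apply/full_row_rankP => s; rewrite mul_mx_row => /no_star_row[hA hB].
  by apply: (key s 0) => //; rewrite scale0r; apply/no_starP.
apply: (key s 1) => // i j; rewrite ord1 {i} scale1r [indR _ _ _ _]mxE.
have := hA j; rewrite mulmxDr mulmx1 mxE [ind s _ _]mxE.
case: (s ord0 j); case: ((ind s *m A) ord0 j) => //= _.
by apply/eqP; exact: oner_neq0.
Qed.

End Strong.

(** * The interface of a node with the rest of the network *)

(** The set [s] certifies that the network loses rank only if it produces no
star in any column. Seen from one node with input at [i], all that matters is
whether [s] contains the input row ([b]) and which symbol [w] the rest of the
network adds along the output row [C]. *)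
Definition blocks n (i : 'I_n) (A : 'M[sym]_n) (C : 'rV[sym]_n) (b : bool)
    (w : sym) : Prop :=
  exists s : 'rV[bool]_n, s ord0 i = b /\ no_star (ind s *m A + w *: C).

Definition insert_row n (i : 'I_n) (b : bool) (s : 'rV[bool]_n.-1) :
    'rV[bool]_n :=
  \row_k if unlift i k is Some k' then s ord0 k' else b.

Lemma insert_row_col' n (i : 'I_n) (s : 'rV[bool]_n) :
  insert_row i (s ord0 i) (col' i s) = s.
Proof.
by apply/rowP => k; rewrite mxE; case: unliftP => [j|] ->; rewrite ?mxE.
Qed.

Lemma ind_insert_row n q (i : 'I_n) (b : bool) (s : 'rV[bool]_n.-1)
    (A : 'M[sym]_(n, q)) :
  ind (insert_row i b s) *m A = (if b then row i A else 0) + ind s *m row' i A.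
Proof.
apply/rowP => l; rewrite !mxE (bigD1_ord i)//=; congr (_ + _).
  rewrite !mxE unlift_none; case: b.
    by rewrite [(Star : sym) * _]mul1r mxE.
  by rewrite mxE [(Zero : sym) * _]mul0r.
by apply: eq_bigr => k _; rewrite !mxE liftK.
Qed.

Lemma ex_insert_row n (i : 'I_n) (b : bool) (P : 'rV[bool]_n -> Prop) :
  (exists s : 'rV[bool]_n, s ord0 i = b /\ P s) <->
  (exists s, P (insert_row i b s)).
Proof.
split=> [[s [<- Ps]]|[s Ps]].
  by exists (col' i s); rewrite insert_row_col'.
by exists (insert_row i b s); rewrite mxE unlift_none.
Qed.

Section NodeBlocks.
Variables (R : realType) (n : nat) (i : 'I_n) (A : 'M[sym]_n) (C : 'rV[sym]_n).

(** In each of the properties [S1] to [S4], the auxiliary row set either contains the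
input row or avoids it, and [C] is added or not: the failure of the property
asserts that some pairs [(b, w)] with [w] equal to [Zero] or [Star] can be
blocked. *)
Lemma not_S2P : ~ S2 R i A <-> blocks i A C true Zero.
Proof.
rewrite dependentP /blocks ex_insert_row.
by split=> -[s hs]; exists s; move: hs;
  rewrite ind_insert_row [(Zero : sym) *: _]scale0r addr0.
Qed.

Lemma not_S4P : ~ S4 R i A C <-> blocks i A C false Star.
Proof.
rewrite dependentP /blocks ex_insert_row.
by split=> -[s hs]; exists s; move: hs;
  rewrite ind_insert_row [(Star : sym) *: _]scale1r add0r addrC.
Qed.

Lemma not_S3P : ~ S3 R A C <-> exists b, blocks i A C b Star.
Proof.
rewrite dependentP; split=> [[s hs]|[b [s [_ hs]]]].
  exists (s ord0 i), s; split=> //.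
  by rewrite [(Star : sym) *: _]scale1r addrC.
by exists s; move: hs; rewrite [(Star : sym) *: _]scale1r addrC.
Qed.

Lemma not_S1P : ~ S1 R i A C <->
  blocks i A C true Zero \/ blocks i A C true Star.
Proof.
have E (s : 'rV[bool]_(n.-1 + 1)) :
    row i A + ind s *m col_mx (row' i A) C =
    ind (insert_row i true (lsubmx s)) *m A +
      (if rsubmx s ord0 ord0 then Star else Zero) *: C.
  rewrite ind_insert_row -addrA -{1}[s]hsubmxK [ind (row_mx _ _)]map_row_mx.
  rewrite mul_row_col; congr (_ + (_ + _)).
  by apply/rowP => l; rewrite !mxE big_ord1 !mxE.
rewrite dependentP /blocks !ex_insert_row; split=> [[s]|].
  by rewrite E; case: (rsubmx _ _ _) => hs; [right|left]; exists (lsubmx s).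
by move=> [] [s hs]; [exists (row_mx s (const_mx false))
  |exists (row_mx s (const_mx true))]; rewrite E row_mxKl row_mxKr mxE.
Qed.

Hypothesis hC : single_star_row C.

(** [Any] is the sum of every symbol with [Any], so only the columns away from
the output count; [w] can then be replaced by whichever of [Zero] and [Star]
does not create a star at the output. *)
Lemma blocks_Any b :
  blocks i A C b Any <-> blocks i A C b Zero \/ blocks i A C b Star.
Proof.
have [j Cj] := hC.
split=> [[s [si hs]]|].
  have [w hw] : exists w, (w = Zero \/ w = Star) /\
      (ind s *m A) ord0 j + w <> Star.
    by case: ((ind s *m A) ord0 j); [exists Zero | exists Star | exists Zero];
      split; (try by left); (try by right).
  have bw : blocks i A C b w.
    exists s; split=> // l; have := hs l; rewrite !mxE !Cj.
    case: eqP => [-> _|_]; last by rewrite ![_ * (Zero : sym)]mulr0.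
    by rewrite [_ * (Star : sym)]mulr1; have := hw.2; rewrite mxE.
  by case: hw.1 => <-; [left|right].
move=> h; have [w [s [si hs]]] : exists w, blocks i A C b w.
  by case: h; eexists; eassumption.
exists s; split=> // l; have := hs l; rewrite !mxE !Cj.
case: eqP => _; last by rewrite ![_ * (Zero : sym)]mulr0.
by case: (\sum_j0 _).
Qed.

(** The union of the two certificates works. At the output the second one
contributes a nonzero symbol, which the union inherits. Elsewhere both sums
are [Zero] or [Any], and a star in the union would come from a single entry,
which would already be the star of one of the two sums. *)
Lemma blocks_union :
  blocks i A C true Zero -> blocks i A C false Star -> blocks i A C true Star.
Proof.
have [j Cj] := hC.
move=> [s [si hs]] [s' [si' hs']].
exists (\row_k (s ord0 k || s' ord0 k)); split; first by rewrite mxE si.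
(* The two sets and their union, split into three disjoint pieces. *)
pose q := ind (\row_k (s ord0 k && ~~ s' ord0 k)).
pose r := ind (\row_k (s ord0 k && s' ord0 k)).
pose t := ind (\row_k (~~ s ord0 k && s' ord0 k)).
have es : ind s = q + r.
  by apply/rowP => k; rewrite !mxE; case: (s ord0 k); case: (s' ord0 k).
have es' : ind s' = r + t.
  by apply/rowP => k; rewrite !mxE; case: (s ord0 k); case: (s' ord0 k).
have eu : ind (\row_k (s ord0 k || s' ord0 k)) = q + r + t.
  by apply/rowP => k; rewrite !mxE; case: (s ord0 k); case: (s' ord0 k).
move=> l; move: (hs l) (hs' l).
rewrite es es' eu !mulmxDl; move: (q *m A) (r *m A) (t *m A) => qA rA tA.
rewrite !mxE Cj; case: (qA ord0 l); case: (rA ord0 l); case: (tA ord0 l);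
  by case: (l == j).
Qed.

End NodeBlocks.

Definition class_table (c : node_class) (b : bool) (w : sym) : bool :=
  match b, w, c with
  | false, Star, (C1 | C4 | C6) => true
  | false, Star, _ => false
  | false, _, _ => true
  | true, Zero, (C2 | C5 | C6) => true
  | true, Star, (C3 | C4 | C5 | C6) => true
  | true, Any, (C2 | C3 | C4 | C5 | C6) => true
  | true, _, _ => false
  end.

(** The classes are mutually exclusive, so the class also tells which conditions
fail. This determines the pairs [(b, w)] that can be blocked, except that [S3]
alone does not separate [(true, Star)] from [(false, Star)]; this matters in
class [C6] only, where [blocks_union] decides. *)
Lemma blocks_class_table (R : realType) n (A : 'M[sym]_n) (B : 'cV[sym]_n)
    (C : 'rV[sym]_n) (i : 'I_n) c :
  (forall j, B j ord0 = if j == i then Star else Zero) ->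
  single_star_row C -> full_row_rank R (row_mx A B) -> node_cond R i A C c ->
  forall b w, blocks i A C b w <-> class_table c b w.
Proof.
move=> hB hC hAB hc.
have [c' [_ uc]] := node_cond_uniq C hB hAB.
have {uc} same c1 : node_cond R i A C c1 -> c1 = c.
  by move=> h; rewrite -(uc _ hc) -(uc _ h).
have b0 : blocks i A C false Zero.
  exists (const_mx false); rewrite mxE; split=> // j.
  rewrite [(Zero : sym) *: _]scale0r addr0 mxE big1// => k _.
  by rewrite !mxE [(Zero : sym) * _]mul0r.
have s1 := not_S1P R i A C; have s2 := not_S2P R i A C.
have s3 := not_S3P R i A C; have s4 := not_S4P R i A C.
have u := @blocks_union _ i A C hC.
have any := @blocks_Any _ i A C hC.
have n3 := same C3; have n1 := same C1.
suff [h1 [h2 h3]] : (blocks i A C false Star <-> class_table c false Star) /\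
   (blocks i A C true Zero <-> class_table c true Zero) /\
   (blocks i A C true Star <-> class_table c true Star).
  case=> -[] //; rewrite any ?h2 ?h3; first by split=> [[]|]; case: (c); auto.
  by split=> // _; left.
have e3 : (exists b, blocks i A C b Star) <->
    blocks i A C true Star \/ blocks i A C false Star.
  by split=> [[[] h]|[] h]; [left|right|exists true|exists false].
rewrite e3 {e3} in s3.
have not_iff (P Q : Prop) (q : bool) : (~ P <-> Q) -> (Q <-> q) -> (P <-> ~~ q).
  case: q => PQ Qq; split=> //; [by move=> HP; case: (PQ.2 (Qq.2 isT))|].
  by move=> _; apply: contrapT => /PQ/Qq.
have [[z zP] [t tP] [p pP]] : [/\ exists z : bool, blocks i A C true Zero <-> z,
    exists t : bool, blocks i A C true Star <-> t &
    exists p : bool, blocks i A C false Star <-> p].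
  by split; eexists; apply: (rwP (asboolP _)).
have {}s1 : S1 R i A C <-> ~~ (z || t).
  by apply: not_iff s1 _; rewrite zP tP; split=> /orP.
have {}s2 := not_iff _ _ _ s2 zP; have {}s4 := not_iff _ _ _ s4 pP.
have {}s3 : S3 R A C <-> ~~ (t || p).
  by apply: not_iff s3 _; rewrite tP pP; split=> /orP.
pose cond c1 := match c1 with
  | C1 => ~~ (z || t) | C2 => ~~ (t || p) | C3 => ~~ z && ~~ p
  | C4 => [&& ~~ z, z || t & p] | C5 => [&& ~~ p, z & t || p]
  | C6 => z && p end.
have condP c1 : node_cond R i A C c1 <-> cond c1.
  have and3E (P Q S : Prop) : [/\ P, Q & S] <-> P /\ Q /\ S.
    by split=> [[]|[? []]].
  case: c1; rewrite /= ?and3E ?s1 ?s2 ?s3 ?s4 //;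
  move: z t p {cond zP tP pP s1 s2 s3 s4} => [] [] []; split=> //=;
    (try by move=> [? []]); (try by case); by move=> _; do ?split.
have {}same c1 : cond c1 -> c1 = c by move/condP/same.
have {}hc : cond c by apply/condP.
have {}u : z -> p -> t by move=> /zP hz /pP hp; apply/tP/u.
rewrite zP tP pP; clear -hc u same.
move: (same C3) (same C1) hc u; rewrite /cond.
by case: z {same cond}; case: t; case: p; case: c => // h1 h2 h3 h4;
  first [by do !split | by move: (h1 isT) | by move: (h2 isT)
        | by move: (h4 isT isT)].
Qed.


(** * The standard nodes *)

Definition std_pos (c : node_class) : 'I_(std_dim c) :=
  match c with C1 | C4 | C6 => ord0 | C2 | C3 | C5 => ord0 end.

Lemma std_B_pos c k : std_B c k ord0 = if k == std_pos c then Star else Zero.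
Proof. by rewrite !mxE; case: c k => -[[|[|k]] kn]. Qed.

Lemma std_entry1 (a : sym) (s : 'rV[bool]_1) (w : sym) j :
  (ind s *m mx_of_rows 1 1 [:: [:: a]] +
     w *: mx_of_rows 1 1 [:: [:: Star]]) ord0 j
  = (if s ord0 ord0 then a else Zero) + w.
Proof.
have -> : j = ord0 by rewrite ord1.
rewrite !mxE big_ord1 !mxE /= [w * Star]mulr1; congr (_ + _).
by case: (s _ _); rewrite ?[(Star : sym) * _]mul1r ?[(Zero : sym) * _]mul0r.
Qed.

Lemma std_entry2 (a00 a01 a10 a11 : sym) (s : 'rV[bool]_2) (w : sym) :
  let v := ind s *m mx_of_rows 2 2 [:: [:: a00; a01]; [:: a10; a11]] +
           w *: mx_of_rows 1 2 [:: [:: Star; Zero]] in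
  let sel b a := if b then a else Zero in
  let b0 := s ord0 ord0 in let b1 := s ord0 (lift ord0 ord0) in
  v ord0 ord0 = sel b0 a00 + sel b1 a10 + w /\
  v ord0 (lift ord0 ord0) = sel b0 a01 + sel b1 a11.
Proof.
move=> v sel b0 b1; rewrite /v !mxE !big_ord_recl !big_ord0 !mxE /=.
rewrite -/b0 -/b1 [w * Star]mulr1 [w * Zero]mulr0 !addr0.
by case: b0; case: b1;
  rewrite ?[(Star : sym) * _]mul1r ?[(Zero : sym) * _]mul0r.
Qed.

Lemma std_blocks c b w :
  blocks (std_pos c) (std_A c) (std_C c) b w <-> class_table c b w.
Proof.
(* Whether the certificate contains the row other than the input row. *)
pose e := match c, b, w with
  | (C1 | C4 | C6), _, Star => true
  | C4, true, _ => true
  | _, _, _ => false end.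
split=> [[s [<- hs]]|h].
  case: c s {e} hs => s hs; move: (hs ord0).
  + have [e0 e1] := std_entry2 Zero Star Star Zero s w.
    move: (hs (lift ord0 ord0)); rewrite e0 e1.
    by case: (s _ _); case: (s _ _); case: w {hs e0 e1}.
  + by rewrite std_entry1; case: (s _ _); case: w {hs}.
  + by rewrite std_entry1; case: (s _ _); case: w {hs}.
  + have [e0 e1] := std_entry2 Zero Star Star Any s w.
    move: (hs (lift ord0 ord0)); rewrite e0 e1.
    by case: (s _ _); case: (s _ _); case: w {hs e0 e1}.
  + by rewrite std_entry1; case: (s _ _); case: w {hs}.
  + have [e0 e1] := std_entry2 Zero Zero Star Zero s w.
    move: (hs (lift ord0 ord0)); rewrite e0 e1.
    by case: (s _ _); case: (s _ _); case: w {hs e0 e1}.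
exists (\row_k if k == std_pos c then b else e).
split; first by rewrite mxE eqxx.
set s := \row_k _; have s0 : s ord0 (std_pos c) = b by rewrite mxE eqxx.
have s1 k : k != std_pos c -> s ord0 k = e by rewrite mxE => /negbTE ->.
move: s s0 s1; rewrite /e => {e}; case: c h => h s s0 s1 j.
+ have [e0 e1] := std_entry2 Zero Star Star Zero s w.
  case: (unliftP ord0 j) => [j'|] ->; rewrite ?ord1 ?e0 ?e1 s0 s1//.
    by move: h; clear; case: b; case: w.
  by move: h; clear; case: b; case: w.
+ by rewrite std_entry1 s0; move: h; clear; case: b; case: w.
+ by rewrite std_entry1 s0; move: h; clear; case: b; case: w.
+ have [e0 e1] := std_entry2 Zero Star Star Any s w.
  case: (unliftP ord0 j) => [j'|] ->; rewrite ?ord1 ?e0 ?e1 s0 s1//.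
    by move: h; clear; case: b; case: w.
  by move: h; clear; case: b; case: w.
+ by rewrite std_entry1 s0; move: h; clear; case: b; case: w.
+ have [e0 e1] := std_entry2 Zero Zero Star Zero s w.
  case: (unliftP ord0 j) => [j'|] ->; rewrite ?ord1 ?e0 ?e1 s0 s1//.
    by move: h; clear; case: b; case: w.
  by move: h; clear; case: b; case: w.
Qed.

Lemma std_unblocked c (s : 'rV[bool]_(std_dim c)) :
  s ord0 (std_pos c) = false -> no_star (ind s *m std_A c) ->
  s = const_mx false.
Proof.
have d2 (t : 'rV[bool]_2) a01 a11 : t ord0 ord0 = false ->
    no_star (ind t *m mx_of_rows 2 2 [:: [:: Zero; a01]; [:: Star; a11]]) ->
    t = const_mx false.
  move=> t0 ht; have := ht ord0.
  have [] := std_entry2 Zero a01 Star a11 t Zero.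
  rewrite [(Zero : sym) *: _]scale0r !addr0 => -> _ h.
  apply/rowP => j; rewrite mxE; case: (unliftP ord0 j) => [j'|] -> //.
  by rewrite ord1; move: h; rewrite t0; case: (t _ _).
case: c s => s s0 hs; try exact: d2 hs.
all: by apply/rowP => j; rewrite ord1 mxE.
Qed.

(** * Full row rank of a network through its nodes *)

Lemma ind_mul_single p (s : 'rV[bool]_p) (v : 'cV[sym]_p) (i0 : 'I_p) :
  (forall j, v j ord0 = if j == i0 then Star else Zero) ->
  \sum_j ind s ord0 j * v j ord0 = ind s ord0 i0.
Proof.
move=> hv; rewrite (bigD1 i0)//= big1 ?addr0 => [|j ji].
  by rewrite hv eqxx [_ * (Star : sym)]mulr1.
by rewrite hv (negbTE ji) [_ * (Zero : sym)]mulr0.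
Qed.

Section Network.
Variables (R : realType) (N m : nat) (d : 'I_N -> nat) (i : forall k, 'I_(d k)).
Variables (A : forall k, 'M[sym]_(d k)) (B : forall k, 'cV[sym]_(d k)).
Variable C : forall k, 'rV[sym]_(d k).
Hypothesis hB : forall k j, B k j ord0 = if j == i k then Star else Zero.
Hypothesis hA : forall k (s : 'rV[bool]_(d k)),
  s ord0 (i k) = false -> no_star (ind s *m A k) ->
  s = const_mx false.

(** The rows in [s] act on the interconnection only through the input rows
among them. *)
Definition inputs (s : 'rV[bool]_(\sum_k d k)) : 'rV[bool]_N :=
  \row_k submxrow s k ord0 (i k).

Lemma ind_mxrow (s : 'rV[bool]_(\sum_k d k)) :
  ind s = \mxrow_k ind (submxrow s k).
Proof. by apply/mxrowP => k; rewrite mxrowK; apply/rowP => j; rewrite !mxE. Qed.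

Lemma ind_mul_diag_cols s : ind s *m diag_cols B = ind (inputs s).
Proof.
rewrite ind_mxrow mul_mxrow_mxcol; apply/rowP => l.
rewrite summxE (bigD1 l)//= big1 ?addr0 => [|k kl].
  rewrite mxE; under eq_bigr do rewrite [X in _ * X]mxE eqxx.
  by rewrite (ind_mul_single _ (@hB l)) !mxE.
rewrite mxE big1// => j _.
by rewrite [X in _ * X]mxE eq_sym (negbTE kl) [_ * (Zero : sym)]mulr0.
Qed.

Lemma mul_diag_rows (v : 'rV[sym]_N) :
  v *m diag_rows C = \mxrow_k (v ord0 k *: C k).
Proof.
rewrite mul_mxrow; apply/mxrowP => k; rewrite !mxrowK; apply/rowP => j.
rewrite mxE (bigD1 k)//= big1 ?addr0 => [|l lk].
  by rewrite !mxE eqxx ord1.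
by rewrite [X in _ * X]mxE (negbTE lk) [_ * (Zero : sym)]mulr0.
Qed.

Lemma no_star_mxrow (v : forall k, 'rV[sym]_(d k)) :
  no_star (\mxrow_k v k) <-> forall k, no_star (v k).
Proof.
split=> [h k j e|h j]; last by rewrite mxE ord1; apply: h.
have /rowP/(_ j) := mxrowK v k; rewrite e mxE; exact: h.
Qed.

Definition network_pattern (W : 'M[sym]_N) (H : 'M[sym]_(N, m)) :=
  row_mx (\mxdiag_k A k + diag_cols B *m W *m diag_rows C) (diag_cols B *m H).

Lemma network_no_star W H s : no_star (ind s *m network_pattern W H) <->
  (forall k, no_star (ind (submxrow s k) *m A k +
      (ind (inputs s) *m W) ord0 k *: C k)) /\
  no_star (ind (inputs s) *m H).
Proof.
rewrite mul_mx_row no_star_row !mulmxDr !mulmxA ind_mul_diag_cols mul_diag_rows.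
by rewrite {1}ind_mxrow mul_mxrow_mxdiag -mxrowD no_star_mxrow.
Qed.

(** A certificate of rank deficiency splits into one certificate per node,
coupled only by the set [beta] of nodes whose input row is used. By [hA], a
certificate with [beta] empty is empty itself. *)
Lemma network_full_row_rank W H : full_row_rank R (network_pattern W H) <->
  forall beta : 'rV[bool]_N,
    (forall k,
      blocks (i k) (A k) (C k) (beta ord0 k) ((ind beta *m W) ord0 k)) ->
    no_star (ind beta *m H) -> beta = const_mx false.
Proof.
rewrite full_row_rankP; split=> h.
  move=> beta hb hH.
  pose f k := sval (cid (hb k)).
  have fP k := svalP (cid (hb k)).
  have fE k : submxrow (\mxrow_k f k) k = f k by rewrite mxrowK.
  have fi : inputs (\mxrow_k f k) = beta.
    by apply/rowP => k; rewrite mxE fE (fP k).1.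
  have s0 : \mxrow_k f k = const_mx false.
    apply: h; apply/network_no_star; rewrite fi; split=> // k.
    by rewrite fE; exact: (fP k).2.
  by rewrite -fi s0 /inputs; apply/rowP => k; rewrite !mxE.
move=> s /network_no_star[hs hH].
have b0 : inputs s = const_mx false.
  by apply: h hH => k; exists (submxrow s k); split; [rewrite !mxE | apply: hs].
apply/mxrowP => k; apply/rowP => j.
have -> : submxrow s k = const_mx false; last by rewrite !mxE.
have inputs0 : submxrow s k ord0 (i k) = false.
  by have /rowP/(_ k) := b0; rewrite !mxE.
apply: hA inputs0 _.
suff -> : ind (submxrow s k) *m A k =
   ind (submxrow s k) *m A k + (ind (inputs s) *m W) ord0 k *: C k by apply: hs.
suff -> : (ind (inputs s) *m W) ord0 k = 0 by rewrite scale0r addr0.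
by rewrite b0 mxE big1// => l _; rewrite !mxE [(Zero : sym) * _]mul0r.
Qed.

End Network.

(** * Realizations of the network *)

Section Selection.
Variables (S : pzSemiRingType) (p N : nat) (f : 'I_N -> 'I_p).
Hypothesis f_inj : injective f.

Definition select_mx : 'M[S]_(p, N) := \matrix_(x, k) (x == f k)%:R.

Lemma select_mul_in q (M : 'M[S]_(N, q)) k y : (select_mx *m M) (f k) y = M k y.
Proof.
rewrite mxE (bigD1 k)//= big1 ?addr0 => [|l lk].
  by rewrite mxE eqxx mul1r.
by rewrite mxE (inj_eq f_inj) eq_sym (negbTE lk) mul0r.
Qed.

Lemma select_mul_out q (M : 'M[S]_(N, q)) x y :
  (forall k, x <> f k) -> (select_mx *m M) x y = 0.
Proof.
move=> h; rewrite mxE big1// => k _.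
by rewrite mxE; case: eqP => [/h|]; rewrite ?mul0r.
Qed.

Lemma mul_select_in q (M : 'M[S]_(q, N)) x l :
  (M *m select_mx^T) x (f l) = M x l.
Proof.
rewrite mxE (bigD1 l)//= big1 ?addr0 => [|k kl].
  by rewrite !mxE eqxx mulr1.
by rewrite !mxE (inj_eq f_inj) eq_sym (negbTE kl) mulr0.
Qed.

Lemma mul_select_out q (M : 'M[S]_(q, N)) x y :
  (forall k, y <> f k) -> (M *m select_mx^T) x y = 0.
Proof.
move=> h; rewrite mxE big1// => k _.
by rewrite !mxE; case: eqP => [/h|]; rewrite ?mulr0.
Qed.

End Selection.

Section Realization.
Variable R : realType.

Lemma in_pattern_select p N (f : 'I_N -> 'I_p) :
  in_pattern (select_mx sym f) (select_mx R f).
Proof.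
by move=> x k; rewrite !mxE; case: eqP => //= _; apply/eqP; exact: oner_neq0.
Qed.

Lemma in_pattern_tr p q (M : 'M[sym]_(p, q)) (X : 'M[R]_(p, q)) :
  in_pattern M X -> in_pattern M^T X^T.
Proof. by move=> h x y; rewrite !mxE. Qed.

(** Since each block of the input and output patterns has one star, the entry
[(k, l)] of [W] reaches only the entry [(f k, g l)] of the network, and no
other entry of [W] reaches that one. So each such entry is split into its two
summands separately, and every realization of the network pattern comes from
realizations of its constituents. *)
Lemma network_realization p N m (A : 'M[sym]_p) (W : 'M[sym]_N)
    (H : 'M[sym]_(N, m)) (f g : 'I_N -> 'I_p) (X : 'M[R]_p) (Y : 'M[R]_(p, m)) :
  injective f -> injective g ->
  in_pattern (A + select_mx sym f *m W *m (select_mx sym g)^T) X ->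
  in_pattern (select_mx sym f *m H) Y ->
  exists A' W' H', [/\ in_pattern A A', in_pattern W W', in_pattern H H',
    X = A' + select_mx R f *m W' *m (select_mx R g)^T &
    Y = select_mx R f *m H'].
Proof.
move=> fI gI hX hY.
have [kl|w hw] := choice (_ : forall kl : 'I_N * 'I_N, exists w : R,
    sym_admits (W kl.1 kl.2) w /\
    sym_admits (A (f kl.1) (g kl.2)) (X (f kl.1) (g kl.2) - w)).
  have := hX (f kl.1) (g kl.2).
  rewrite mxE -mulmxA select_mul_in// mul_select_in//.
  by move=> /admits_split[a [w [ha hw ->]]]; exists w; rewrite addrK.
pose W' : 'M[R]_N := \matrix_(k, l) w (k, l).
pose V := select_mx R f *m W' *m (select_mx R g)^T.
exists (X - V), W', (\matrix_(k, j) Y (f k) j); split.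
- move=> x y; rewrite 2!mxE.
  have [[k ->]|hx] := pselect (exists k, x = f k); last first.
    have hx' k : x <> f k by move=> e; apply: hx; exists k.
    have := hX x y; rewrite mxE -mulmxA select_mul_out// addr0.
    by rewrite /V -mulmxA select_mul_out// subr0.
  have [[l ->]|hy] := pselect (exists l, y = g l); last first.
    have hy' l : y <> g l by move=> e; apply: hy; exists l.
    by have := hX (f k) y; rewrite mxE !mul_select_out// addr0 subr0.
  rewrite /V -mulmxA select_mul_in// mul_select_in// mxE.
  exact: (hw (k, l)).2.
- by move=> k l; rewrite mxE; exact: (hw (k, l)).1.
- by move=> k j; have := hY (f k) j; rewrite select_mul_in// mxE.
- by rewrite subrK.
- apply/matrixP => x j; have [[k ->]|hx] := pselect (exists k, x = f k).
    by rewrite select_mul_in// mxE.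
  have hx' k : x <> f k by move=> e; apply: hx; exists k.
  by rewrite select_mul_out//; have := hY x j; rewrite select_mul_out.
Qed.

Lemma network_controllableP p N m (A : 'M[sym]_p) (W : 'M[sym]_N)
    (H : 'M[sym]_(N, m)) (f g : 'I_N -> 'I_p) :
  injective f -> injective g ->
  let B := select_mx sym f in let C := (select_mx sym g)^T in
  network_controllable R A B C W H <->
  (forall X Y, in_pattern (A + B *m W *m C) X -> in_pattern (B *m H) Y ->
    controllable (R := R) X Y).
Proof.
move=> fI gI B C; split=> [h X Y hX hY|h A' B' C' W' H' hA hB hC hW hH].
  have [A' [W' [H' [hA hW hH -> ->]]]] := network_realization fI gI hX hY.
  apply: h => //; first exact: in_pattern_select.
  exact/in_pattern_tr/in_pattern_select.
by apply: h; [apply: in_patternD => //; apply: in_patternM => //|];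
  apply: in_patternM.
Qed.

End Realization.

(** * Block diagonal patterns *)

Section Diagonal.
Variables (N : nat) (d : 'I_N -> nat).

Lemma single_star_pos (B : forall k, 'cV[sym]_(d k)) :
  (forall k, single_star_col (B k)) ->
  exists i : forall k, 'I_(d k),
    forall k j, B k j ord0 = if j == i k then Star else Zero.
Proof.
move=> hB; exists (fun k => sval (cid (hB k))) => k.
exact: svalP (cid (hB k)).
Qed.

Lemma single_star_row_pos (C : forall k, 'rV[sym]_(d k)) :
  (forall k, single_star_row (C k)) ->
  exists j : forall k, 'I_(d k),
    forall k l, C k ord0 l = if l == j k then Star else Zero.
Proof.
move=> hC; exists (fun k => sval (cid (hC k))) => k.
exact: svalP (cid (hC k)).
Qed.

Variable i : forall k, 'I_(d k).

Definition block_pos (k : 'I_N) : 'I_(\sum_k d k) := @tagnat.Rank _ d k (i k).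

Lemma block_pos_inj : injective block_pos.
Proof.
move=> k l /(congr1 (@nat_of_ord _))/eqP.
by rewrite tagnat.eq_Rank => /andP[/eqP].
Qed.

Lemma block_posP (x : 'I_(\sum_k d k)) k :
  (x == block_pos k) = (tagnat.sig1 x == k) && (tagnat.sig2 x == i k :> nat).
Proof. by rewrite -tagnat.eq_Rank tagnat.sig2K. Qed.

Lemma diag_cols_select (B : forall k, 'cV[sym]_(d k)) :
  (forall k j, B k j ord0 = if j == i k then Star else Zero) ->
  diag_cols B = select_mx sym block_pos.
Proof.
move=> hB; apply/matrixP => x k; rewrite !mxE block_posP hB eq_sym.
by case: eqP => //= <-; rewrite val_eqE; case: eqP.
Qed.

Lemma diag_rows_select (C : forall k, 'rV[sym]_(d k)) :
  (forall k j, C k ord0 j = if j == i k then Star else Zero) ->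
  diag_rows C = (select_mx sym block_pos)^T.
Proof.
move=> hC; apply/matrixP => k x; rewrite !mxE block_posP hC eq_sym.
by case: eqP => //= <-; rewrite val_eqE; case: eqP.
Qed.

End Diagonal.

Lemma bar_patternE n (A : 'M[sym]_n) : bar_pattern A = A + 1%:M.
Proof.
by apply/matrixP => i j; rewrite !mxE; case: (i == j); rewrite /= ?addr0 //;
  case: (A i j).
Qed.

Lemma full_row_rank_unblocked (R : realType) n (i : 'I_n) (A : 'M[sym]_n)
    (B : 'cV[sym]_n) (s : 'rV[bool]_n) :
  (forall j, B j ord0 = if j == i then Star else Zero) ->
  full_row_rank R (row_mx A B) ->
  s ord0 i = false -> no_star (ind s *m A) -> s = const_mx false.
Proof.
move=> hB /full_row_rankP h si hs; apply: h; rewrite mul_mx_row.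
apply/no_star_row; split=> // j; have -> : j = ord0 by rewrite ord1.
rewrite mxE (ind_mul_single _ hB).
by rewrite mxE si.
Qed.

(** A node and its standard node block the same pairs [(b, w)], so replacing
all nodes does not change which sets [beta] certify a loss of rank. *)
Lemma standard_full_row_rank (R : realType) (N m : nat) (d : 'I_N -> nat)
    (A : forall k, 'M[sym]_(d k)) (B : forall k, 'cV[sym]_(d k))
    (C : forall k, 'rV[sym]_(d k)) (c : 'I_N -> node_class)
    (W : 'M[sym]_N) (H : 'M[sym]_(N, m)) :
  (forall k, single_star_col (B k)) -> (forall k, single_star_row (C k)) ->
  (forall k, full_row_rank R (row_mx (A k) (B k))) ->
  (forall k, has_class R (A k) (B k) (C k) (c k)) ->
  full_row_rank R (network_pattern A B C W H) <->
  full_row_rank R (std_network c W H).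
Proof.
move=> hB hC hAB hc.
have [i iP] := single_star_pos hB.
have tabA k b w : blocks (i k) (A k) (C k) b w <-> class_table (c k) b w.
  apply: (blocks_class_table (iP k) (hC k) (hAB k)); have [j [Bj]] := hc k.
  by have := iP k j; rewrite Bj; case: eqP => // ->.
have unA k (s : 'rV[bool]_(d k)) :=
  @full_row_rank_unblocked R _ (i k) (A k) _ s (iP k) (hAB k).
rewrite (@network_full_row_rank R N m d i A B C iP unA W H).
rewrite (@network_full_row_rank R N m _ (fun k => std_pos (c k)) _ _
  (fun k => std_C (c k)) (fun k => @std_B_pos (c k))
  (fun k => @std_unblocked (c k)) W H).
by split=> h beta hb; apply: h => k; have := hb k;
  [move/std_blocks/tabA | move/tabA/std_blocks].
Qed.

Theorem theorem18 (R : realType) (N m : nat) (hN : (1 <= N)%N) (hm : (1 <= m)%N)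
    (n : 'I_N -> nat)
    (A : forall k, 'M[sym]_(n k))
    (B : forall k, 'cV[sym]_(n k))
    (C : forall k, 'rV[sym]_(n k))
    (hB : forall k, single_star_col (B k))
    (hC : forall k, single_star_row (C k))
    (hAB : forall k, full_row_rank R (row_mx (A k) (B k)))
    (hbarAB : forall k, full_row_rank R (row_mx (bar_pattern (A k)) (B k)))
    (W : 'M[sym]_N) (H : 'M[sym]_(N, m))
    (c cbar : 'I_N -> node_class)
    (hc : forall k, has_class R (A k) (B k) (C k) (c k))
    (hcbar : forall k, has_class R (bar_pattern (A k)) (B k) (C k) (cbar k)) :
  network_controllable R
    (\mxdiag_(k < N) A k) (diag_cols B) (diag_rows C) W H
  <->
  full_row_rank R (std_network c W H) /\ full_row_rank R (std_network cbar W H).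
Proof.
rewrite -(standard_full_row_rank W H hB hC hAB hc).
rewrite -(standard_full_row_rank W H hB hC hbarAB hcbar).
have [i iP] := single_star_pos hB.
have [j jP] := single_star_row_pos hC.
have -> : network_pattern (fun k => bar_pattern (A k)) B C W H =
    row_mx (\mxdiag_k A k + diag_cols B *m W *m diag_rows C + 1%:M)
      (diag_cols B *m H).
  rewrite /network_pattern; congr row_mx.
  rewrite addrAC -(mxdiagZ 1) -mxdiagD; congr (_ + _).
  by apply: eq_mxdiag => k; rewrite bar_patternE.
rewrite -strong_controllabilityP (diag_cols_select iP) (diag_rows_select jP).
apply: network_controllableP; exact: block_pos_inj.
Qed.
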